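(* Let $G=(V,E)$ be a generically 3-isostatic graph, let $X\subset V$ with $|X|=5$, let $e,f$ be distinct edges in $E(X)$, and let $G'$ be the graph obtained from $G$ by deleting the edges $e$ and $f$ and adding a new vertex adjacent to exactly the five vertices of $X$. Suppose that there are four distinct vertices $a,b,c,d\in X$ such that $ab$, $bc$, $ca$ and $cd$ are all implied edges of $G-\{e,f\}$ (that is, $G-\{e,f\}$ contains an implied subgraph, with vertices in $X$, consisting of a triangle together with one further edge joining a vertex of the triangle to a fourth vertex). Then either $G-\{e,f\}$ contains an implied $K_4$ whose vertices are in $X$, or $G'$ is generically 3-rigid.
   Context: Graphs are finite, simple and undirected. $E(X)$ is the set of edges of $G$ both of whose endpoints lie in $X$; $G-\{e,f\}$ is $G$ with the edges $e,f$ removed (same vertex set). A (3-dimensional) framework is a pair $(G,\rho)$ with $\rho\in\mathbb R^{3\times|V|}$, where $\rho_i$ denotes the column (point of $\mathbb R^3$) assigned to vertex $i$. An infinitesimal flex of $(G,\rho)$ is $u\in\mathbb R^{3\times |V|}$ with $(u_i-u_j)^T(\rho_i-\rho_j)=0$ for all $ij\in E$. It is trivial if there are a skew symmetric $a\in\mathbb R^{3\times 3}$ and $t\in\mathbb R^3$ with $u_i=t+a\rho_i$ for all $i$. The framework is infinitesimally rigid if every infinitesimal flex is trivial; it is isostatic if it is infinitesimally rigid and deleting any edge of $G$ gives a framework that is not infinitesimally rigid. The configuration $\rho$ is generic if the multiset of its entries is algebraically independent over $\mathbb Q$. $G$ is generically 3-rigid (respectively generically 3-isostatic) if $(G,\rho)$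 is infinitesimally rigid (respectively isostatic) for every generic $\rho\in\mathbb R^{3\times|V|}$. For a graph $\Gamma$ and vertices $i,j$ of $\Gamma$, $ij$ is an implied edge of $\Gamma$ (in three dimensions) if every infinitesimal flex $u$ of a generic 3-dimensional framework $(\Gamma,\rho)$ satisfies $(u_i-u_j)^T(\rho_i-\rho_j)=0$. (Every edge of $\Gamma$ is an implied edge.) An implied $K_4$ of $\Gamma$ is a set of implied edges of $\Gamma$ forming a complete graph on 4 vertices. *)

(* Defs.v *)
From HB Require Import structures.
From mathcomp Require Import mpoly. (* before all_boot, since it shadows [symmetric] *)
From mathcomp Require Import all_boot all_order all_algebra.
From mathcomp Require Import reals.

Set Implicit Arguments.
Unset Strict Implicit.
Unset Printing Implicit Defensive.

Import Order.TTheory GRing.Theory Num.Theory.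
Local Open Scope ring_scope.

Record sgraph (V : finType) := SGraph {
  adj :> rel V;
  adj_sym : symmetric adj;
  adj_irrefl : irreflexive adj }.

(* An edge ij is the unordered pair [set i; j]. *)
Definition edges (V : finType) (G : sgraph V) : {set {set V}} :=
  [set s | [exists i, exists j, G i j && (s == [set i; j])]].

Definition edges_in (V : finType) (G : sgraph V) (X : {set V}) : {set {set V}} :=
  [set s in edges G | s \subset X].

Section GraphOperations.
Variables (V : finType) (G : sgraph V).

Definition del_adj (F : {set {set V}}) : rel V :=
  fun i j => G i j && ([set i; j] \notin F).

Lemma del_adj_sym F : symmetric (del_adj F).
Proof. by move=> i j; rewrite /del_adj adj_sym setUC. Qed.

Lemma del_adj_irrefl F : irreflexive (del_adj F).
Proof. by move=> i; rewrite /del_adj adj_irrefl. Qed.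

Definition del_edges (F : {set {set V}}) : sgraph V :=
  SGraph (del_adj_sym F) (del_adj_irrefl F).

(* On [option V], the new vertex is [None]. *)
Definition cone_adj (X : {set V}) : rel (option V) :=
  fun p q => match p, q with
  | Some i, Some j => G i j
  | Some i, None | None, Some i => i \in X
  | None, None => false
  end.

Lemma cone_adj_sym X : symmetric (cone_adj X).
Proof. by move=> [i|] [j|] //=; rewrite adj_sym. Qed.

Lemma cone_adj_irrefl X : irreflexive (cone_adj X).
Proof. by move=> [i|] //=; rewrite adj_irrefl. Qed.

Definition add_vertex (X : {set V}) : sgraph (option V) :=
  SGraph (cone_adj_sym X) (cone_adj_irrefl X).

End GraphOperations.

Section Rigidity.
Variable R : realType.

(* Independence of the family x: a repeated value makes it dependent. *)
Definition alg_independent (I : finType) (x : I -> R) : Prop :=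
  forall p : {mpoly rat[#|I|]},
    mmap (ratr : rat -> R) (fun k : 'I_#|I| => x (enum_val k)) p = 0 -> p = 0.

Section Frameworks.
Variable V : finType.

(* The i-th column of a 3 x |V| matrix is [rho i]. *)
Definition config := {ffun V -> 'cV[R]_3}.

Implicit Types (G : sgraph V) (rho u : config).

(* (u_i - u_j)^T (rho_i - rho_j) = 0, as an equation between 1 x 1 matrices. *)
Definition flex_eq rho u (i j : V) : Prop :=
  (u i - u j)^T *m (rho i - rho j) = 0.

Definition inf_flex G rho u : Prop := forall i j, G i j -> flex_eq rho u i j.

Definition trivial_flex rho u : Prop :=
  exists (a : 'M[R]_3) (t : 'cV[R]_3),
    a^T = - a /\ forall i, u i = t + a *m rho i.

Definition inf_rigid G rho : Prop :=
  forall u, inf_flex G rho u -> trivial_flex rho u.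

Definition isostatic G rho : Prop :=
  inf_rigid G rho /\
  forall e, e \in edges G -> ~ inf_rigid (del_edges G [set e]) rho.

Definition generic rho : Prop :=
  alg_independent (fun ki : 'I_3 * V => rho ki.2 ki.1 0).

Definition generically_3rigid G : Prop :=
  forall rho, generic rho -> inf_rigid G rho.

Definition generically_3isostatic G : Prop :=
  forall rho, generic rho -> isostatic G rho.

(* "A generic framework" is read as "every generic framework". *)
Definition implied_edge G (i j : V) : Prop :=
  forall rho, generic rho -> forall u, inf_flex G rho u -> flex_eq rho u i j.

(* An implied K_4 is given by its vertex set. *)
Definition implied_K4 G (S : {set V}) : Prop :=
  #|S| = 4%N /\
  forall i j, i \in S -> j \in S -> i != j -> implied_edge G i j.

End Frameworks.
End Rigidity.

(* Main.v *)
(* Work at a generic configuration rho of V and put H = G - {e, f}, X = {a, b, c, d, x}.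
   The rates of change of the lengths of e and f show that the flexes u of H modulo
   trivial ones form a space of dimension at most 2; normalise them by u_a = u_b = u_c = 0.
   Placing the new vertex at a point p off the plane abc forces its velocity to vanish,
   so u extends if and only if u_d.(p - rho_d) = 0 and u_x.(p - rho_x) = 0.  If abcd is not
   an implied K_4 then some flex has u_d <> 0, and if abcx is not one then some flex has
   u_x <> 0.  Since all the u_d are orthogonal to rho_c - rho_d and rho_x is not on the
   line cd, this makes the 2 x 2 determinant of the two extension conditions a nonzero
   polynomial in p (if the space is 2-dimensional).  A suitable p gives a rigid
   realisation of G', and rigidity passes to all generic configurations because ranks of
   matrices of polynomials are maximal at generic points. *)
Require Import Defs.
From HB Require Import structures.
From mathcomp Require Import mpoly.
From mathcomp Require Import all_boot all_order all_algebra.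
From mathcomp Require Import boolp reals.
From mathcomp Require Import ring lra.

Set Implicit Arguments.
Unset Strict Implicit.
Unset Printing Implicit Defensive.

Import GRing.Theory Num.Theory.
Local Open Scope ring_scope.

(** * Rank in terms of nonvanishing minors *)

Lemma exists_rank_minor (F : fieldType) (m n : nat) (A : 'M[F]_(m, n)) :
  exists (g : 'I_(\rank A) -> 'I_m) (h : 'I_(\rank A) -> 'I_n),
    \det (mxsub g h A) != 0.
Proof.
pose B := rowsub (maxrankfun A) A.
have fullBt : row_full B^T by rewrite /row_full mxrank_tr; exact: maxrowsub_free.
exists (maxrankfun A), (fullrankfun fullBt).
rewrite -unitfE -unitmxE -unitmx_tr.
have -> : (mxsub (maxrankfun A) (fullrankfun fullBt) A)^T =
          rowsub (fullrankfun fullBt) B^T by apply/matrixP => i j; rewrite !mxE.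
exact: fullrowsub_unit.
Qed.

Lemma minor_le_rank (F : fieldType) (m n r : nat) (A : 'M[F]_(m, n))
    (g : 'I_r -> 'I_m) (h : 'I_r -> 'I_n) :
  \det (mxsub g h A) != 0 -> (r <= \rank A)%N.
Proof.
rewrite -unitfE -unitmxE -row_free_unit => /eqP rk; rewrite -[leqLHS]rk.
have -> : mxsub g h A = rowsub g 1%:M *m (A *m colsub h 1%:M).
  by rewrite mul_rowsub_mx mul1mx mulmx_colsub mulmx1 -mxsub_comp.
exact: leq_trans (mxrankM_maxr _ _) (mxrankM_maxl _ _).
Qed.

(** * Matrices of rational polynomials evaluated at algebraically independent points *)

Section RankTransfer.
Variables (R : realType) (n : nat).

Definition rateval (x : 'I_n -> R) : {mpoly rat[n]} -> R := mmap (ratr : rat -> R) x.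

HB.instance Definition _ x := GRing.RMorphism.on (rateval x).

Lemma ratevalX x i : rateval x 'X_i = x i.
Proof. by rewrite /rateval mmapX mmap1U. Qed.

(** A minor that is nonzero at [y] is a nonzero polynomial, so it cannot vanish at the algebraically
    independent point [x]. *)
Lemma mxrank_rateval_le m k (M : 'M[{mpoly rat[n]}]_(m, k)) (x y : 'I_n -> R) :
  (forall p, rateval x p = 0 -> p = 0) ->
  (\rank (map_mx (rateval y) M) <= \rank (map_mx (rateval x) M))%N.
Proof.
move=> gx; have [g [h]] := exists_rank_minor (map_mx (rateval y) M).
rewrite -map_mxsub det_map_mx => dy; apply: (minor_le_rank (g := g) (h := h)).
rewrite -map_mxsub det_map_mx; apply: contra_neq dy => /gx ->.
exact: rmorph0.
Qed.
End RankTransfer.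

(** * Flexes and trivial flexes as linear algebra over polynomial matrices *)

Section RigidityMatrix.
Variables (R : realType) (V : finType).
Notation coordinate := ('I_3 * V)%type.
Notation N := #|{: coordinate}|.
Implicit Types (rho u : config R V) (E : rel V).

Definition coords rho : 'I_N -> R :=
  fun r => rho (enum_val r).2 (enum_val r).1 0.

Definition vec u : 'rV[R]_N := \row_r coords u r.

Definition unvec (w : 'rV[R]_N) : config R V :=
  [ffun v => \col_k w 0 (enum_rank (k, v))].

Lemma unvecK : cancel unvec vec.
Proof.
by move=> w; apply/rowP=> r; rewrite mxE /coords ffunE mxE -surjective_pairing enum_valK.
Qed.

Lemma sum_coordinate (F : coordinate -> R) :
  \sum_(r < N) F (enum_val r) = \sum_k \sum_v F (k, v).
Proof.
rewrite pair_bigA /= -(big_enum_val F); apply: eq_bigr => -[] //.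
Qed.

Definition Xcoord (v : V) (k : 'I_3) : {mpoly rat[N]} := 'X_(enum_rank (k, v)).

Definition coord_eval rho : {mpoly rat[N]} -> R := rateval (coords rho).

HB.instance Definition _ rho := GRing.RMorphism.on (coord_eval rho).

Lemma coord_evalX rho v k : coord_eval rho (Xcoord v k) = rho v k 0.
Proof. by rewrite /coord_eval ratevalX /coords enum_rankK. Qed.

Lemma generic_coord_eval rho :
  generic rho -> forall p, coord_eval rho p = 0 -> p = 0.
Proof. exact. Qed.

(** The transposed rigidity matrix: flexes form its left kernel. Every ordered pair has a column,
    zero for a non-edge, so the size does not depend on [E]; and [E] is a mere relation, so that a
    single pair can be adjoined to a graph. *)
Definition rigidity_mx E : 'M[{mpoly rat[N]}]_(N, #|{: V * V}|) :=
  \matrix_(r, s) let: (k, v) := enum_val r in let: (i, j) := enum_val s in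
    if E i j then ((v == i)%:R - (v == j)%:R) * (Xcoord i k - Xcoord j k) else 0.

Lemma flex_eqE rho u i j :
  flex_eq rho u i j <-> \sum_k (u i k 0 - u j k 0) * (rho i k 0 - rho j k 0) = 0.
Proof.
have -> : \sum_k (u i k 0 - u j k 0) * (rho i k 0 - rho j k 0) =
  ((u i - u j)^T *m (rho i - rho j)) 0 0.
  by rewrite mxE; apply: eq_bigr => k _; rewrite !mxE.
rewrite /flex_eq; split=> [-> | h]; first by rewrite mxE.
by apply/matrixP=> p q; rewrite !ord1 h mxE.
Qed.

Lemma vec_rigidity_mx E rho u :
  vec u *m map_mx (coord_eval rho) (rigidity_mx E) = 0 <->
  (forall i j, E i j -> flex_eq rho u i j).
Proof.
pose S i j := \sum_k (u i k 0 - u j k 0) * (rho i k 0 - rho j k 0).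
have entry s : (vec u *m map_mx (coord_eval rho) (rigidity_mx E)) 0 s =
    if E (enum_val s).1 (enum_val s).2 then S (enum_val s).1 (enum_val s).2 else 0.
  rewrite mxE; case es: (enum_val s) => [i j] /=.
  under eq_bigr => r _ do rewrite !mxE es [coords _ _]/(u (enum_val r).2 (enum_val r).1 0).
  rewrite (eq_bigr (fun r => (fun kv : coordinate => u kv.2 kv.1 0 *
     (if E i j then ((kv.2 == i)%:R - (kv.2 == j)%:R) * (rho i kv.1 0 - rho j kv.1 0)
      else 0)) (enum_val r))); last first.
    move=> r _; case: (enum_val r) => k v /=; congr (_ * _).
    case: (E i j); last by rewrite rmorph0.
    by rewrite rmorphM !rmorphB /= !rmorph_nat !coord_evalX.
  rewrite (sum_coordinate (fun kv : coordinate => u kv.2 kv.1 0 *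
     (if E i j then ((kv.2 == i)%:R - (kv.2 == j)%:R) * (rho i kv.1 0 - rho j kv.1 0)
      else 0))) /=.
  case: (E i j); last by rewrite big1 // => k _; rewrite big1 // => v _; rewrite mulr0.
  apply: eq_bigr => k _.
  have delta i0 : \sum_v u v k 0 * (v == i0)%:R = u i0 k 0.
    rewrite (bigD1 i0) //= eqxx mulr1 big1 ?addr0 // => v /negPf ->.
    by rewrite mulr0.
  rewrite -(delta i) -(delta j) -sumrB mulr_suml; apply: eq_bigr => v _.
  by rewrite -mulrBr mulrA.
split=> [h0 i j Eij | h].
  apply/flex_eqE; have := congr1 (fun A : 'M_(_, _) => A 0 (enum_rank (i, j))) h0.
  by rewrite entry enum_rankK /= Eij mxE.
apply/rowP=> s; rewrite entry mxE; case: ifP => // /h /flex_eqE //.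
Qed.

(** Its rows generate the trivial flexes: one elementary rotation for each ordered pair of axes,
    with redundancy, and one translation for each axis. *)
Definition trivial_mx : 'M[{mpoly rat[N]}]_(#|{: 'I_3 * 'I_3 + 'I_3}|, N) :=
  \matrix_(s, r) let: (k, v) := enum_val r in
    match enum_val s with
    | inl (i, j) => (k == i)%:R * Xcoord v j - (k == j)%:R * Xcoord v i
    | inr i => (k == i)%:R
    end.

Lemma trivial_flexE rho u :
  trivial_flex rho u <-> (vec u <= map_mx (coord_eval rho) trivial_mx)%MS.
Proof.
have entry (D : 'rV[R]_#|{: 'I_3 * 'I_3 + 'I_3}|) k v :
    (D *m map_mx (coord_eval rho) trivial_mx) 0 (enum_rank (k, v)) =
    D 0 (enum_rank (inr k)) + \sum_j
      (D 0 (enum_rank (inl (k, j))) - D 0 (enum_rank (inl (j, k)))) * rho v j 0.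
  pose T (s : 'I_3 * 'I_3 + 'I_3) : R := D 0 (enum_rank s) * match s with
    | inl (i, j) => (k == i)%:R * rho v j 0 - (k == j)%:R * rho v i 0
    | inr i => (k == i)%:R
    end.
  rewrite mxE (eq_bigr (fun s => T (enum_val s))); last first.
    move=> s _; rewrite !mxE enum_rankK /T enum_valK; congr (_ * _).
    case: (enum_val s) => [[i j]|i]; last by rewrite rmorph_nat.
    by rewrite rmorphB !rmorphM !rmorph_nat /= !coord_evalX.
  rewrite -(big_enum_val T) big_sumType /= addrC; congr (_ + _).
    rewrite (bigD1 k) //= big1 ?addr0; first by rewrite /T eqxx mulr1.
    by move=> i; rewrite /T eq_sym => /negPf ->; rewrite mulr0.
  transitivity (\sum_i \sum_j T (inl (i, j))).
    by rewrite pair_bigA; apply: eq_big => // -[].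
  transitivity (\sum_i (\sum_j D 0 (enum_rank (inl (i, j))) * ((k == i)%:R * rho v j 0) +
      \sum_j - (D 0 (enum_rank (inl (i, j))) * ((k == j)%:R * rho v i 0)))).
    apply: eq_bigr => i _; rewrite -big_split; apply: eq_bigr => j _.
    by rewrite /T mulrBr.
  rewrite big_split /=.
  transitivity (\sum_j D 0 (enum_rank (inl (k, j))) * rho v j 0 +
                \sum_j - (D 0 (enum_rank (inl (j, k))) * rho v j 0)); last first.
    by rewrite -big_split; apply: eq_bigr => j _; rewrite mulrBl.
  congr (_ + _).
    rewrite (bigD1 k) //= [X in _ + X]big1 ?addr0.
      by apply: eq_bigr => j _; rewrite eqxx mul1r.
    move=> i; rewrite eq_sym => /negPf ->.
    by rewrite big1 // => j _; rewrite mul0r mulr0.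
  apply: eq_bigr => i _; rewrite (bigD1 k) //= [X in _ + X]big1 ?addr0.
    by rewrite eqxx mul1r.
  by move=> j; rewrite eq_sym => /negPf ->; rewrite mul0r mulr0 oppr0.
split=> [[a [t [skew_a eq_u]]] | /submxP [D eq_u]].
  apply/submxP.
  (* Each entry of [a] is produced by both [(i, j)] and [(j, i)], hence the factor 1/2. *)
  exists (\row_s match enum_val s with inl (i, j) => a i j / 2%:R | inr i => t i 0 end).
  apply/rowP=> r; rewrite -(enum_valK r); case: (enum_val r) => k v.
  rewrite entry !mxE /coords !enum_rankK eq_u /= !mxE; congr (_ + _).
  apply: eq_bigr => j _; rewrite !mxE !enum_rankK; congr (_ * _).
  have -> : a j k = - a k j.
    by have := congr1 (fun A : 'M_3 => A k j) skew_a; rewrite !mxE.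
  by field.
exists (\matrix_(k, j) (D 0 (enum_rank (inl (k, j))) - D 0 (enum_rank (inl (j, k))))).
exists (\col_k D 0 (enum_rank (inr k))); split.
  by apply/matrixP=> k j; rewrite !mxE opprB.
move=> v; apply/colP=> k.
have := congr1 (fun A : 'M_(_, _) => A 0 (enum_rank (k, v))) eq_u.
rewrite entry mxE /coords enum_rankK /= => ->; rewrite !mxE; congr (_ + _).
by apply: eq_bigr => j _; rewrite !mxE.
Qed.

(** For skew [a] the scalar [d^T a d] is the negative of its own transpose, hence zero. *)
Lemma trivial_flex_eq rho u i j : trivial_flex rho u -> flex_eq rho u i j.
Proof.
case=> a [t [skew_a eq_u]]; rewrite /flex_eq !eq_u.
rewrite opprD addrACA subrr add0r -mulmxBr trmx_mul skew_a.
set d := rho i - rho j.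
have h : (d^T *m a *m d)^T = - (d^T *m a *m d).
  by rewrite !trmx_mul trmxK skew_a mulNmx mulmxN mulmxA.
rewrite mulmxN mulNmx; apply/matrixP=> p q; rewrite !ord1.
have := congr1 (fun A : 'M_1 => A 0 0) h; rewrite !mxE; lra.
Qed.

(* Rigidity at one configuration suffices, even a non-generic one: both the flex
   space and the space of trivial flexes have extremal dimension at generic points. *)
Lemma inf_rigid_generic (G : sgraph V) rho :
  inf_rigid G rho -> generically_3rigid R G.
Proof.
move=> rig_rho sigma gen_sigma.
pose Rm x := map_mx (coord_eval x) (rigidity_mx G).
pose Tm x := map_mx (coord_eval x) trivial_mx.
have kerP x u : inf_flex G x u <-> (vec u <= kermx (Rm x))%MS.
  rewrite sub_kermx; split=> [h | /eqP /vec_rigidity_mx //].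
  by apply/eqP/vec_rigidity_mx.
have ker_sub : (kermx (Rm rho) <= Tm rho)%MS.
  apply/row_subP=> i; rewrite -(unvecK (row i _)); apply/trivial_flexE/rig_rho.
  by apply/kerP; rewrite unvecK row_sub.
have sub_ker : (Tm sigma <= kermx (Rm sigma))%MS.
  apply/row_subP=> i; rewrite -(unvecK (row i _)); apply/kerP => p q _.
  by apply/trivial_flex_eq/trivial_flexE; rewrite unvecK row_sub.
(* With K for the flex space and T for the trivial one: dim K(sigma) <= dim K(rho) <= dim T(rho) <=
   dim T(sigma), while T(sigma) lies in K(sigma). *)
have eq_ker : (kermx (Rm sigma) <= Tm sigma)%MS.
  rewrite -(geq_leqif (mxrank_leqif_sup sub_ker)).
  have leT := mxrank_rateval_le trivial_mx (coords rho) (generic_coord_eval gen_sigma).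
  apply: leq_trans leT; apply: leq_trans (mxrankS ker_sub).
  rewrite !mxrank_ker leq_sub2l //.
  exact: mxrank_rateval_le (rigidity_mx G) _ _ (generic_coord_eval gen_sigma).
by move=> u /kerP h; apply/trivial_flexE; exact: submx_trans h eq_ker.
Qed.

(** Adjoining [ij] to the edges leaves the rank at [rho] unchanged. Both ranks, with and without
    [ij], take the same value at all generic configurations, so the kernels agree at [sigma] as
    well. *)
Lemma implied_edge_generic (G : sgraph V) i j rho :
  generic rho -> (forall u, inf_flex G rho u -> flex_eq rho u i j) ->
  implied_edge R G i j.
Proof.
move=> gen_rho imp_rho sigma gen_sigma.
pose E p q := G p q || ((p == i) && (q == j)).
pose Rm (F : rel V) x := map_mx (coord_eval x) (rigidity_mx F).
have kerP (F : rel V) x u :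
    (forall p q, F p q -> flex_eq x u p q) <-> (vec u <= kermx (Rm F x))%MS.
  rewrite sub_kermx; split=> [h | /eqP /vec_rigidity_mx //].
  by apply/eqP/vec_rigidity_mx.
have ker_rho : (kermx (Rm G rho) <= kermx (Rm E rho))%MS.
  apply/row_subP=> r; rewrite -(unvecK (row r _)); apply/kerP => p q.
  have fl : inf_flex G rho (unvec (row r (kermx (Rm G rho)))).
    by apply/kerP; rewrite unvecK row_sub.
  by case/orP=> [/fl // | /andP[/eqP -> /eqP ->]]; exact: imp_rho.
have ker_sigma : (kermx (Rm E sigma) <= kermx (Rm G sigma))%MS.
  apply/row_subP=> r; rewrite -(unvecK (row r _)); apply/kerP => p q Gpq.
  have /kerP fl : (vec (unvec (row r (kermx (Rm E sigma)))) <= kermx (Rm E sigma))%MS.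
    by rewrite unvecK row_sub.
  by apply: fl; rewrite /E Gpq.
have eq_ker : (kermx (Rm G sigma) <= kermx (Rm E sigma))%MS.
  rewrite -(geq_leqif (mxrank_leqif_sup ker_sigma)).
  have le_ker := mxrankS ker_rho.
  have leE := mxrank_rateval_le (rigidity_mx E) (coords sigma) (generic_coord_eval gen_rho).
  have leG := mxrank_rateval_le (rigidity_mx G) (coords rho) (generic_coord_eval gen_sigma).
  move: le_ker; rewrite !mxrank_ker => le_ker.
  (* Subtraction is truncated, so cancelling it needs this bound on the rank. *)
  have r1 := rank_leq_row (Rm E rho).
  apply: leq_sub2l; apply: leq_trans leE _; apply: leq_trans leG.
  by rewrite leq_sub2lE in le_ker.
move=> u /kerP fl; have /kerP h := submx_trans fl eq_ker.
by apply: h; rewrite /E !eqxx orbT.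
Qed.

End RigidityMatrix.

(** * Dot products, cross products and skew matrices in dimension three *)

Section Space.
Variable R : realFieldType.
Implicit Types (v w z p q : 'cV[R]_3) (s : R).

Definition dot v w : R := \sum_k v k 0 * w k 0.

(** Indices in ['I_3] add modulo 3, so one cyclic formula gives all three coordinates. *)
Definition cross v w : 'cV[R]_3 :=
  \col_k (v (k + 1) 0 * w (k + 2%:R) 0 - v (k + 2%:R) 0 * w (k + 1) 0).

Lemma dotE v w : dot v w = v 0 0 * w 0 0 + v 1 0 * w 1 0 + v 2%:R 0 * w 2%:R 0.
Proof.
rewrite /dot !big_ord_recl big_ord0 addr0 addrA.
congr (_ * _ + _ * _ + _ * _).
all: congr (_ _ 0); exact: val_inj.
Qed.

Lemma crossE v w :
  (cross v w 0 0 = v 1 0 * w 2%:R 0 - v 2%:R 0 * w 1 0) *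
  (cross v w 1 0 = v 2%:R 0 * w 0 0 - v 0 0 * w 2%:R 0) *
  (cross v w 2%:R 0 = v 0 0 * w 1 0 - v 1 0 * w 0 0).
Proof.
have e0 : 0 + 1 = 1 :> 'I_3 by apply: val_inj.
have e1 : 0 + 2%:R = 2%:R :> 'I_3 by apply: val_inj.
have e2 : 1 + 1 = 2%:R :> 'I_3 by apply: val_inj.
have e3 : 1 + 2%:R = 0 :> 'I_3 by apply: val_inj.
have e4 : 2%:R + 1 = 0 :> 'I_3 by apply: val_inj.
have e5 : 2%:R + 2%:R = 1 :> 'I_3 by apply: val_inj.
by split; [split|]; rewrite mxE ?(e0, e1, e2, e3, e4, e5).
Qed.

Lemma colvE :
  (forall v w k, (v + w) k 0 = v k 0 + w k 0) *
  (forall v k, (- v) k 0 = - v k 0) *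
  (forall s v k, (s *: v) k 0 = s * v k 0).
Proof. by split; [split|] => *; rewrite mxE. Qed.

Lemma col3P v w :
  v 0 0 = w 0 0 -> v 1 0 = w 1 0 -> v 2%:R 0 = w 2%:R 0 -> v = w.
Proof.
move=> h0 h1 h2; apply/colP=> -[[|[|[|//]]] lt3].
- by have -> : Ordinal lt3 = 0 by apply: val_inj.
- by have -> : Ordinal lt3 = 1 by apply: val_inj.
- by have -> : Ordinal lt3 = 2%:R by apply: val_inj.
Qed.

Lemma dotC v w : dot v w = dot w v.
Proof. by apply: eq_bigr => k _; rewrite mulrC. Qed.

Lemma dotDl v w z : dot (v + w) z = dot v z + dot w z.
Proof. by rewrite -big_split; apply: eq_bigr => k _; rewrite mxE mulrDl. Qed.

Lemma dotNl v z : dot (- v) z = - dot v z.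
Proof. by rewrite -sumrN; apply: eq_bigr => k _; rewrite mxE mulNr. Qed.

Lemma dotZl s v z : dot (s *: v) z = s * dot v z.
Proof. by rewrite mulr_sumr; apply: eq_bigr => k _; rewrite mxE mulrA. Qed.

Lemma dotBl v w z : dot (v - w) z = dot v z - dot w z.
Proof. by rewrite dotDl dotNl. Qed.

Lemma dot0l z : dot 0 z = 0.
Proof. by rewrite -(scale0r z) dotZl mul0r. Qed.

Lemma dotDr v w z : dot z (v + w) = dot z v + dot z w.
Proof. by rewrite !(dotC z) dotDl. Qed.

Lemma dotBr v w z : dot z (v - w) = dot z v - dot z w.
Proof. by rewrite !(dotC z) dotBl. Qed.

Lemma dotZr s v z : dot z (s *: v) = s * dot z v.
Proof. by rewrite !(dotC z) dotZl. Qed.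

Lemma dot_eq0 v : (dot v v == 0) = (v == 0).
Proof.
apply/idP/eqP=> [|->]; last by rewrite dot0l.
rewrite psumr_eq0 => [/allP h|k _]; last by rewrite -expr2 sqr_ge0.
apply/colP=> k; have := h k (mem_index_enum _).
by rewrite mulf_eq0 orbb mxE => /eqP.
Qed.

(* Expansion of z in the basis v, w, v x w, cleared of denominators. *)
Lemma frame_expansion v w z : let n := cross v w in
  dot n n *: z = dot z n *: n + dot z w *: cross n v - dot z v *: cross n w.
Proof. by move=> n; apply: col3P; rewrite !colvE !dotE /n !crossE; ring. Qed.

Lemma frame_orthogonal v w z : dot z v = 0 -> dot z w = 0 ->
  dot (cross v w) (cross v w) *: z = dot z (cross v w) *: cross v w.
Proof. by move=> zv zw; rewrite frame_expansion zv zw !scale0r addr0 subr0. Qed.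

(** Being orthogonal to [v] and [w], [z] is a multiple of their cross product, on which pairing with
    [p] is injective. *)
Lemma frame_orthogonal_eq0 v w p z :
  dot p (cross v w) != 0 ->
  dot z v = 0 -> dot z w = 0 -> dot z p = 0 -> z = 0.
Proof.
move=> np zv zw zp; have eq_z := frame_orthogonal zv zw.
set n := cross v w in np eq_z.
have nn : dot n n != 0 by rewrite dot_eq0; apply: contraNneq np => ->; rewrite dotC dot0l.
have zn : dot z n = 0.
  apply/eqP; rewrite -(mulIr_eq0 _ (mulIf np)) (dotC p) -dotZl -eq_z dotZl zp.
  by rewrite mulr0.
by move/eqP: eq_z; rewrite zn scale0r scaler_eq0 (negPf nn) => /eqP.
Qed.

Lemma skew_dot (a : 'M[R]_3) v w : a^T = - a -> dot (a *m v) w = - dot v (a *m w).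
Proof.
have dot_mx p q : dot p q = (p^T *m q) 0 0.
  by rewrite mxE; apply: eq_bigr => k _; rewrite mxE.
move=> skew_a; rewrite !dot_mx trmx_mul skew_a mulmxN mulNmx mulmxA.
by rewrite mxE.
Qed.

(** By skewness the image of [a] is orthogonal to [v] and [w], hence lies along [n]. In particular
    [a n] is a multiple of [n]; it is also orthogonal to [n], so it is zero, and then so is [a]. *)
Lemma skew_eq0 (a : 'M[R]_3) v w :
  a^T = - a -> cross v w != 0 -> a *m v = 0 -> a *m w = 0 -> a = 0.
Proof.
move=> skew_a; rewrite -dot_eq0; set n := cross v w => nn av aw.
have a_eq y : dot n n *: (a *m y) = - dot y (a *m n) *: n.
  rewrite frame_orthogonal -/n ?skew_dot //.
    by rewrite av dotC dot0l oppr0.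
  by rewrite aw dotC dot0l oppr0.
have an : a *m n = 0.
  have /eqP := a_eq n; rewrite (_ : dot n (a *m n) = 0).
    by rewrite oppr0 scale0r scaler_eq0 (negPf nn) => /eqP.
  by have := skew_dot n n skew_a; rewrite dotC; lra.
apply/matrixP=> i j; have := a_eq (delta_mx j 0).
rewrite an (dotC _ 0) dot0l oppr0 scale0r => /eqP.
rewrite scaler_eq0 (negPf nn) /= -colE => /eqP /(congr1 (fun u : 'cV_3 => u i 0)).
by rewrite !mxE.
Qed.

Definition wedge v w : 'M[R]_3 := v *m w^T - w *m v^T.

Lemma wedge_skew v w : (wedge v w)^T = - wedge v w.
Proof. by rewrite /wedge linearB /= !trmx_mul !trmxK opprB. Qed.

Lemma wedge_mul v w z : wedge v w *m z = dot w z *: v - dot v z *: w.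
Proof.
have mul_dot p q : p *m q^T *m z = dot q z *: p.
  rewrite -mulmxA [q^T *m z]mx11_scalar mul_mx_scalar; congr (_ *: _).
  by rewrite mxE; apply: eq_bigr => k _; rewrite mxE.
by rewrite mulmxBl !mul_dot.
Qed.

(* Up to the factor [dot n n], [cross w n] and [cross n v] are dual to v and w. *)
Lemma triangle_rigid v w p q :
  cross v w != 0 -> dot p v = 0 -> dot q w = 0 -> dot p w + dot q v = 0 ->
  exists a : 'M[R]_3, [/\ a^T = - a, a *m v = p & a *m w = q].
Proof.
rewrite -dot_eq0; set n := cross v w => nn pv qw pw_qv.
pose v' := cross w n; pose w' := cross n v.
have v'v : dot v' v = dot n n by rewrite /v' /n !dotE !crossE; ring.
have v'w : dot v' w = 0 by rewrite /v' /n !dotE !crossE; ring.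
have w'v : dot w' v = 0 by rewrite /w' /n !dotE !crossE; ring.
have w'w : dot w' w = dot n n by rewrite /w' /n !dotE !crossE; ring.
(* The first two wedges send [v] to [p] and [w] to [q] up to scale, with errors along [w'] and [v'].
   The third wedge cancels both errors at once, because [dot p w = - dot q v]. *)
exists ((dot n n)^-1 *: (wedge p v' + wedge q w' + (dot q v / dot n n) *: wedge w' v')).
split.
- have trZ c (a : 'M[R]_3) : (c *: a)^T = c *: a^T by apply/matrixP=> i j; rewrite !mxE.
  have trD (a b : 'M[R]_3) : (a + b)^T = a^T + b^T by apply/matrixP=> i j; rewrite !mxE.
  by rewrite trZ 2!trD trZ !wedge_skew !scalerN -!opprD scalerN.
- rewrite -scalemxAl 2!mulmxDl -scalemxAl !wedge_mul v'v w'v pv.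
  rewrite !scale0r !subr0 sub0r scalerA divfK // addrNK.
  by rewrite scalerA mulVf // scale1r.
- rewrite -scalemxAl 2!mulmxDl -scalemxAl !wedge_mul v'w w'w qw.
  rewrite !scale0r !subr0 !sub0r scalerN scalerA divfK //.
  have -> : dot q v = - dot p w by lra.
  rewrite scaleNr opprK addrAC addNr add0r.
  by rewrite scalerA mulVf // scale1r.
Qed.

End Space.

(** * Functions that are polynomial along every line *)

Section PolynomialOnLines.
Variable R : realFieldType.
Implicit Types (F G : 'cV[R]_3 -> R) (v p q : 'cV[R]_3).

Definition line_poly F :=
  forall p q, exists P : {poly R}, forall s, F (p + s *: (q - p)) = P.[s].

Lemma line_polyM F G : line_poly F -> line_poly G -> line_poly (fun p => F p * G p).
Proof.
move=> lF lG p q; have [[P hP] [Q hQ]] := (lF p q, lG p q).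
by exists (P * Q) => s; rewrite hornerM hP hQ.
Qed.

Lemma line_polyB F G : line_poly F -> line_poly G -> line_poly (fun p => F p - G p).
Proof.
move=> lF lG p q; have [[P hP] [Q hQ]] := (lF p q, lG p q).
by exists (P - Q) => s; rewrite hornerD hornerN hP hQ.
Qed.

Lemma line_poly_dot v q : line_poly (fun p => dot v (p - q)).
Proof.
move=> p p'; exists ((dot v (p - q))%:P + dot v (p' - p) *: 'X) => s.
by rewrite hornerD hornerC hornerZ hornerX addrAC [LHS]dotDr dotZr mulrC.
Qed.

Lemma dot_witness v q : v != 0 -> exists p, dot v (p - q) != 0.
Proof. by move=> v0; exists (q + v); rewrite addrAC subrr add0r dot_eq0. Qed.

(** On the line through [p] and [q] both functions are polynomials in [s], nonzero at [s = 0] and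
    [s = 1] respectively. Their product is a nonzero polynomial and cannot vanish at as many
    integers as its size. *)
Lemma common_nonzero F G p q :
  line_poly F -> line_poly G -> F p != 0 -> G q != 0 ->
  exists r, F r != 0 /\ G r != 0.
Proof.
move=> lF lG Fp Gq; have [[P hP] [Q hQ]] := (lF p q, lG p q).
have PQ0 : P * Q != 0.
  rewrite mulf_neq0 //.
    by apply: contraNneq Fp => P0; rewrite -[p]addr0 -(scale0r (q - p)) hP P0 horner0.
  apply: contraNneq Gq => Q0.
  by have := hQ 1; rewrite scale1r addrC subrK Q0 horner0 => ->.
pose s := [seq (i%:R : R) | i <- iota 0 (size (P * Q))].
have us : uniq s by rewrite map_inj_uniq ?iota_uniq // => i j /eqP; rewrite eqr_nat => /eqP.
have : ~~ all (root (P * Q)) s.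
  apply/negP=> all_s; have := max_poly_roots PQ0 all_s us.
  by rewrite size_map size_iota ltnn.
case/allPn=> t _; rewrite /root hornerM mulf_eq0 negb_or -hP -hQ => /andP[Ft Gt].
by exists (p + t *: (q - p)).
Qed.
End PolynomialOnLines.

(** * Choosing the position of the new vertex *)

Section NewVertex.
Variables (R : realType) (V : finType) (S : config R V -> Prop).
Variables (rho : config R V) (c d x : V) (T : 'cV[R]_3 -> R).
Hypothesis S_lin : forall s z w, S z -> S w -> S (s *: z + w).
Hypothesis S_span : forall u w, S u -> S w ->
  (forall s t, s *: u + t *: w = 0 -> s = 0 /\ t = 0) ->
  forall z, S z -> exists s t, z = s *: u + t *: w.
Hypothesis S_inj : forall z, S z -> z d = 0 -> z x = 0 -> z = 0.
Hypothesis S_hinge : forall z, S z -> dot (z d) (rho c - rho d) = 0.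
Hypothesis cdx : cross (rho c - rho d) (rho x - rho d) != 0.
Hypothesis T_poly : line_poly T.
Hypothesis T_neq0 : exists p, T p != 0.

Let ld (z : config R V) (p : 'cV[R]_3) := dot (z d) (p - rho d).
Let lx (z : config R V) (p : 'cV[R]_3) := dot (z x) (p - rho x).
(** [S] stands for the space of pinned flexes, [S_span] for its dimension being at most 2, and [T]
    for a condition keeping [p] off a plane. At a good [p] only the zero flex meets both extension
    conditions [ld] and [lx]. *)
Let good p := T p != 0 /\ forall z, S z -> ld z p = 0 -> lx z p = 0 -> z = 0.

Let ldZD s z t w p : ld (s *: z + t *: w) p = s * ld z p + t * ld w p.
Proof. by rewrite /ld !ffunE dotDl !dotZl. Qed.

Let lxZD s z t w p : lx (s *: z + t *: w) p = s * lx z p + t * lx w p.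
Proof. by rewrite /lx !ffunE dotDl !dotZl. Qed.

(** The determinant and [T] are both nonzero at some common [p]. There Cramer's rule shows that [u]
    and [w] are independent, so they span [S], and that the two conditions are injective on their
    span. *)
Lemma good_of_det u w q : S u -> S w ->
  ld u q * lx w q - ld w q * lx u q != 0 -> exists p, good p.
Proof.
move=> Su Sw Dq; have [q' Tq'] := T_neq0.
have [|p [Dp Tp]] :=
  common_nonzero (F := fun q => ld u q * lx w q - ld w q * lx u q) _ T_poly Dq Tq'.
  by apply: line_polyB; apply: line_polyM; apply: line_poly_dot.
have indep s t : s * ld u p + t * ld w p = 0 -> s * lx u p + t * lx w p = 0 ->
    s = 0 /\ t = 0.
  move=> h1 h2; split; apply: (mulIf Dp); rewrite mul0r.
    transitivity (lx w p * (s * ld u p + t * ld w p) - ld w p * (s * lx u p + t * lx w p)).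
      by ring.
    by rewrite h1 h2; ring.
  transitivity (ld u p * (s * lx u p + t * lx w p) - lx u p * (s * ld u p + t * ld w p)).
    by ring.
  by rewrite h1 h2; ring.
exists p; split=> // z Sz ldz lxz.
have [|s [t eq_z]] := S_span Su Sw _ Sz.
  move=> s t eq0; apply: indep; rewrite -?ldZD -?lxZD eq0.
    by rewrite /ld ffunE dot0l.
  by rewrite /lx ffunE dot0l.
move: ldz lxz; rewrite eq_z ldZD lxZD => h1 h2.
by have [-> ->] := indep _ _ h1 h2; rewrite !scale0r addr0.
Qed.

Lemma good_position u1 u2 : S u1 -> u1 d != 0 -> S u2 -> u2 x != 0 ->
  exists p, good p.
Proof.
move=> Su1 u1d Su2 u2x.
have S_comb s z t w : S z -> S w -> S (s *: z + t *: w).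
  move=> Sz Sw; apply: (S_lin _ Sz); rewrite -[t *: w]addr0.
  apply: (S_lin _ Sw); rewrite -(subrr z) addrC -scaleN1r; exact: S_lin.
have prod_nonzero (u w : config R V) : u d != 0 -> w x != 0 -> exists q, ld u q * lx w q != 0.
  move=> /(dot_witness (rho d)) [p hp] /(dot_witness (rho x)) [p' hp'].
  have [||q [h1 h2]] := common_nonzero (F := ld u) (G := lx w) _ _ hp hp'; try exact: line_poly_dot.
  by exists q; rewrite mulf_neq0.
(* If some flex in [S] vanishes at exactly one of [d] and [x], the determinant reduces to a single
   product of two nonzero affine functions. *)
have [[w [Sw wd wx]]|nA] := pselect (exists w : config R V, [/\ S w, w d = 0 & w x != 0]).
  have [q hq] := prod_nonzero _ _ u1d wx.
  have ldw : ld w q = 0 by rewrite /ld wd dot0l.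
  by apply: (good_of_det Su1 Sw (q := q)); rewrite ldw mul0r subr0.
have [[w [Sw wx wd]]|nB] := pselect (exists w : config R V, [/\ S w, w x = 0 & w d != 0]).
  have [q hq] := prod_nonzero _ _ wd u2x.
  have lxw : lx w q = 0 by rewrite /lx wx dot0l.
  by apply: (good_of_det Sw Su2 (q := q)); rewrite lxw mulr0 subr0.
(* From here on, evaluation at [d] and evaluation at [x] are each injective on [S]. *)
have d0 (z : config R V) : S z -> z d = 0 -> z = 0.
  move=> Sz zd; apply: (S_inj Sz zd); apply/eqP; apply: contrapT => /negP zx.
  by apply: nA; exists z.
have x0 (z : config R V) : S z -> z x = 0 -> z = 0.
  move=> Sz zx; apply: (S_inj Sz _ zx); apply/eqP; apply: contrapT => /negP zd.
  by apply: nB; exists z.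
(* If [S] is the line through [u1], the condition at [d] alone suffices; otherwise [u1] and [w] are
   independent. *)
have [mult|/existsNP [w /not_implyP [Sw nmult]]] :=
    pselect (forall w, S w -> exists t, w = t *: u1).
  have [[q Tq] [q' hq']] := (T_neq0, dot_witness (rho d) u1d).
  have [|p [h1 h2]] := common_nonzero (F := ld u1) _ T_poly hq' Tq; first exact: line_poly_dot.
  exists p; split=> // z /mult [t ->]; rewrite /ld ffunE dotZl => /eqP.
  by rewrite mulf_eq0 (negPf h1) orbF => /eqP -> _; rewrite scale0r.
(* [A z] is the value of [ld z] at [p = rho x], the point where every [lx] vanishes. *)
pose A (z : config R V) := dot (z d) (rho x - rho d).
(* Otherwise u1 d and w d are parallel, and some combination of u1 and w vanishes at d. *)
have nA0 : A u1 != 0 \/ A w != 0.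
  apply: contrapT => /not_orP [/negP/negPn/eqP Au1 /negP/negPn/eqP Aw].
  pose n := cross (rho c - rho d) (rho x - rho d).
  have nn : dot n n != 0 by rewrite dot_eq0.
  have n_eq (z : config R V) : S z -> A z = 0 -> dot n n *: z d = dot (z d) n *: n.
    by move=> Sz Az; apply: frame_orthogonal => //; exact: S_hinge.
  have u1n : dot (u1 d) n != 0.
    apply: contraNneq u1d => u1n; have /eqP := n_eq _ Su1 Au1.
    by rewrite u1n scale0r scaler_eq0 (negPf nn).
  have : dot (u1 d) n *: w + (- dot (w d) n) *: u1 = 0.
    have Sz := S_comb (dot (u1 d) n) w (- dot (w d) n) u1 Sw Su1.
    apply: (d0 _ Sz); apply/eqP; have := n_eq _ Sz.
    rewrite {1}/A !ffunE !dotDl !dotZl -/(A w) -/(A u1) Aw Au1 !mulr0 addr0.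
    move=> /(_ erefl); rewrite mulrC mulNr subrr scale0r => /eqP.
    by rewrite scaler_eq0 (negPf nn).
  rewrite scaleNr => /eqP; rewrite subr_eq0 => /eqP eq_w.
  apply: nmult; exists ((dot (u1 d) n)^-1 * dot (w d) n).
  by rewrite -scalerA -eq_w scalerA mulVf // scale1r.
(* With A v = 0 and A u <> 0, the determinant of u, v vanishes only to first order
   at p = rho x. *)
pose v := A w *: u1 + (- A u1) *: w.
have Sv : S v by exact: S_comb.
have Av : A v = 0.
  by rewrite /A /v !ffunE dotDl !dotZl -/(A w) -/(A u1); ring.
have v0 : v != 0.
  apply/eqP; rewrite /v scaleNr => /eqP; rewrite subr_eq0 => /eqP eq_w.
  have [Au1|Au1] := eqVneq (A u1) 0.
    case: nA0 => [|Aw]; first by rewrite Au1 eqxx.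
    move/eqP: eq_w; rewrite Au1 scale0r scaler_eq0 (negPf Aw) /= => /eqP u10.
    by rewrite u10 ffunE eqxx in u1d.
  apply: nmult; exists ((A u1)^-1 * A w).
  by rewrite -scalerA eq_w scalerA mulVf // scale1r.
have [u [Su Au]] : exists u, S u /\ A u != 0 by case: nA0; [exists u1 | exists w].
clearbody v; have vx : v x != 0 by apply: contraNneq v0 => /(x0 _ Sv) ->.
set g := v x in vx.
have gg : dot g g != 0 by rewrite dot_eq0.
pose K := dot (u d) g * dot g g - dot (v d) g * dot (u x) g.
have D_eq s : let q := rho x + s *: g in
    ld u q * lx v q - ld v q * lx u q = s * (A u * dot g g) + s ^+ 2 * K.
  rewrite /= /ld /lx -/g [_ + _ - rho d]addrAC [_ + _ - rho x]addrAC subrr add0r.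
  rewrite !dotZr 2!(dotDr (rho x - rho d)) !dotZr -/(A u).
  rewrite [dot (v d) (rho x - rho d)]Av /K; ring.
have c0 : A u * dot g g != 0 by rewrite mulf_neq0.
(* With a nonzero linear coefficient, the quadratic in [s] cannot vanish at both 1 and -1. *)
have [D1|D1] := eqVneq (1 * (A u * dot g g) + 1 ^+ 2 * K) 0; last first.
  by apply: (good_of_det Su Sv (q := rho x + 1 *: g)); rewrite D_eq.
apply: (good_of_det Su Sv (q := rho x + (-1) *: g)); rewrite D_eq.
by apply: contraNneq c0 => Dm1; apply/eqP; move: D1 Dm1; lra.
Qed.

End NewVertex.

(** * Flex equations, generic triangles and pinning *)

Section Flexes.
Variables (R : realType) (V : finType).
Implicit Types (rho u w z : config R V) (G : sgraph V).

Lemma flex_eq_dot rho u i j :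
  flex_eq rho u i j <-> dot (u i - u j) (rho i - rho j) = 0.
Proof.
rewrite flex_eqE; suff -> : dot (u i - u j) (rho i - rho j) =
  \sum_k (u i k 0 - u j k 0) * (rho i k 0 - rho j k 0) by [].
by apply: eq_bigr => k _; rewrite !mxE.
Qed.

Lemma flex_eq_sym rho u i j : flex_eq rho u i j -> flex_eq rho u j i.
Proof.
rewrite !flex_eq_dot -[u j - _]opprB -[rho j - _]opprB => h.
by rewrite dotNl dotC dotNl dotC h !oppr0.
Qed.

Lemma flex_eq_zero rho u i j : u i = 0 -> u j = 0 -> flex_eq rho u i j.
Proof. by rewrite flex_eq_dot => -> ->; rewrite subr0 dot0l. Qed.

Lemma flex_eq_lin rho s z w i j :
  flex_eq rho z i j -> flex_eq rho w i j -> flex_eq rho (s *: z + w) i j.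
Proof.
rewrite !flex_eq_dot => hz hw; rewrite !ffunE opprD addrACA -scalerBr dotDl dotZl.
by rewrite hz hw mulr0 addr0.
Qed.

Lemma flex_eq_sub rho z w i j :
  flex_eq rho z i j -> flex_eq rho w i j -> flex_eq rho (z - w) i j.
Proof. by move=> hz hw; rewrite addrC -scaleN1r; apply: flex_eq_lin. Qed.

(** One coordinate of the cross product is a rational polynomial in the configuration. It is not the
    zero polynomial, since it equals 1 when [a] is the origin and [b], [c] are unit vectors. *)
Lemma generic_noncollinear rho a b c : generic rho -> uniq [:: a; b; c] ->
  cross (rho b - rho a) (rho c - rho a) != 0.
Proof.
move=> gen_rho; rewrite /= !inE andbT => /andP[/norP[ab ac] bc].
pose P := (Xcoord b 0 - Xcoord a 0) * (Xcoord c 1 - Xcoord a 1)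
        - (Xcoord b 1 - Xcoord a 1) * (Xcoord c 0 - Xcoord a 0).
have eval_P (sigma : config R V) : coord_eval sigma P =
    cross (sigma b - sigma a) (sigma c - sigma a) 2%:R 0.
  by rewrite crossE !(rmorphB, rmorphM) /= !coord_evalX !colvE.
apply: contraPneq (oner_neq0 R) => cross0; apply/negP; rewrite negbK.
have P0 : P = 0.
  by apply: (generic_coord_eval gen_rho); rewrite eval_P cross0 mxE.
pose sigma : config R V := [ffun v =>
  if v == b then delta_mx 0 0 else if v == c then delta_mx 1 0 else 0].
have := eval_P sigma; rewrite P0 rmorph0 crossE !colvE !ffunE eqxx.
rewrite (negPf ab) (negPf ac) eqxx eq_sym (negPf bc) !mxE /= => ->.
by rewrite !subr0 mulr1 mulr0 subr0.
Qed.

Lemma trivial_flex_eq0 rho z a b c :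
  cross (rho b - rho a) (rho c - rho a) != 0 -> trivial_flex rho z ->
  z a = 0 -> z b = 0 -> z c = 0 -> z = 0.
Proof.
move=> abc [m [t [skew_m eq_z]]] za zb zc.
have m0 : m = 0.
  by apply: (skew_eq0 skew_m abc); rewrite mulmxBr;
    [have := subrr (0 : 'cV[R]_3); rewrite -{1}zb -za
    | have := subrr (0 : 'cV[R]_3); rewrite -{1}zc -za];
    rewrite !eq_z opprD addrACA subrr add0r.
move: za; rewrite eq_z m0 mul0mx addr0 => t0.
by apply/ffunP=> v; rewrite eq_z m0 mul0mx t0 addr0 ffunE.
Qed.

(** [triangle_rigid] applies to the edge vectors at [a]: given the equations for [ab] and [ca], the
    one for [bc] becomes its mixed hypothesis. *)
Lemma pin_triangle rho u a b c :
  cross (rho b - rho a) (rho c - rho a) != 0 ->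
  flex_eq rho u a b -> flex_eq rho u b c -> flex_eq rho u c a ->
  exists w, [/\ trivial_flex rho w, w a = u a, w b = u b & w c = u c].
Proof.
move=> abc /flex_eq_sym /flex_eq_dot ab /flex_eq_dot bc /flex_eq_dot ca.
have [|m [skew_m mb mc]] := triangle_rigid abc ab ca.
  move: bc; have shift (p : config R V) : p b - p c = (p b - p a) - (p c - p a).
    by rewrite opprB addrA subrK.
  rewrite (shift u) (shift rho) dotBl !(dotBr (rho b - rho a)) ab ca; lra.
exists [ffun i => u a + m *m (rho i - rho a)]; split.
- exists m, (u a - m *m rho a); split=> // i.
  by rewrite ffunE mulmxBr addrA addrAC.
- by rewrite ffunE subrr mulmx0 addr0.
- by rewrite ffunE mb addrC subrK.
- by rewrite ffunE mc addrC subrK.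
Qed.

Lemma edges_inP G (X : {set V}) (e : {set V}) : e \in edges_in G X ->
  exists i j, [/\ e = [set i; j], i \in X & j \in X].
Proof.
rewrite !inE => /andP[/existsP[i /existsP[j /andP[_ /eqP ->]]]].
by move=> /subsetP sub; exists i, j; split=> //; apply: sub; rewrite !inE eqxx ?orbT.
Qed.

Lemma flex_eq_set2 rho u i j p q : [set i; j] = [set p; q] :> {set V} ->
  flex_eq rho u p q -> flex_eq rho u i j.
Proof.
move=> eq_ij pq.
have : i \in [set p; q] by rewrite -eq_ij set21.
have : j \in [set p; q] by rewrite -eq_ij set22.
have : p \in [set i; j] by rewrite eq_ij set21.
have : q \in [set i; j] by rewrite eq_ij set22.
rewrite !inE; case/orP=> /eqP eq1 /orP[] /eqP eq2 /orP[] /eqP eq3 /orP[] /eqP eq4;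
  subst => //; by [apply: flex_eq_sym | exact/flex_eq_dot].
Qed.

End Flexes.

(** * Pinned flexes and a rigid realisation with the new vertex *)

Section Extension.
Variables (R : realType) (V : finType) (G : sgraph V) (X e f : {set V}).
Variables (rho : config R V) (a b c d x : V).
Notation H := (del_edges G [set e; f]).
Hypothesis gen_rho : generic rho.
Hypothesis rig_rho : inf_rigid G rho.
Hypothesis eX : e \in edges_in G X.
Hypothesis fX : f \in edges_in G X.
Hypothesis uniq_X : uniq [:: a; b; c; d; x].
Hypothesis mem_X : X =i [:: a; b; c; d; x].
Hypothesis imp_ab : implied_edge R H a b.
Hypothesis imp_bc : implied_edge R H b c.
Hypothesis imp_ca : implied_edge R H c a.
Hypothesis imp_cd : implied_edge R H c d.

Definition pinned_flex (z : config R V) :=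
  inf_flex H rho z /\ [/\ z a = 0, z b = 0 & z c = 0].

Lemma pinned_flex_lin s z w :
  pinned_flex z -> pinned_flex w -> pinned_flex (s *: z + w).
Proof.
move=> [fz [za zb zc]] [fw [wa wb wc]]; split.
  by move=> i j Hij; apply: flex_eq_lin; [exact: fz|exact: fw].
by rewrite !ffunE za zb zc wa wb wc scaler0 addr0.
Qed.

Lemma abc_noncollinear : cross (rho b - rho a) (rho c - rho a) != 0.
Proof.
apply: generic_noncollinear => //.
by move: uniq_X; rewrite (cat_uniq [:: a; b; c] [:: d; x]) => /and3P[].
Qed.

(** The implied triangle lets a trivial flex match [u] at [a], [b], [c]. Subtracting it does not
    affect any flex equation. *)
Lemma exists_pinned_flex u : inf_flex H rho u ->
  exists z, pinned_flex z /\ forall i j, flex_eq rho z i j -> flex_eq rho u i j.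
Proof.
move=> fu; have [||| w [tw wa wb wc]] := pin_triangle (u := u) abc_noncollinear.
- exact: imp_ab. - exact: imp_bc. - exact: imp_ca.
exists (u - w); split.
  split; last by rewrite !ffunE wa wb wc !subrr.
  by move=> i j Hij; apply: flex_eq_sub; [exact: fu | exact: trivial_flex_eq].
move=> i j h; rewrite -[u](subrK w) -[u - w]scale1r.
by apply: flex_eq_lin => //; exact: trivial_flex_eq.
Qed.

(** Respecting [e] and [f] too makes [z] a flex of the rigid framework on [G], hence trivial; a
    trivial flex that vanishes at three noncollinear points is zero. *)
Lemma pinned_flex_eq0 z ie je jf kf : pinned_flex z ->
  e = [set ie; je] -> f = [set jf; kf] ->
  flex_eq rho z ie je -> flex_eq rho z jf kf -> z = 0.
Proof.
move=> [fz [za zb zc]] eq_e eq_f ze zf.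
apply: (trivial_flex_eq0 abc_noncollinear) => //; apply: rig_rho => i j Gij.
have [ije|ije] := eqVneq [set i; j] e.
  by apply: flex_eq_set2 ze; rewrite ije.
have [ijf|ijf] := eqVneq [set i; j] f.
  by apply: flex_eq_set2 zf; rewrite ijf.
by apply: fz; rewrite /= /del_adj Gij !inE negb_or ije ijf.
Qed.

(** Such a [z] vanishes on all of [X], which contains the ends of [e] and [f], so it respects both
    edges. *)
Lemma pinned_flex_inj z : pinned_flex z -> z d = 0 -> z x = 0 -> z = 0.
Proof.
move=> Sz zd zx; have [_ [za zb zc]] := Sz.
have zX i : i \in X -> z i = 0.
  by rewrite mem_X !inE => /or4P[|||/orP[]] /eqP ->.
have [[i [j [eq_e iX jX]]] [p [q [eq_f pX qX]]]] := (edges_inP eX, edges_inP fX).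
by apply: (pinned_flex_eq0 Sz eq_e eq_f); apply: flex_eq_zero; exact: zX.
Qed.

(* Pinned flexes embed in R^2 by the rates of change of the lengths of e and f. *)
Lemma pinned_flex_span u w : pinned_flex u -> pinned_flex w ->
  (forall s t, s *: u + t *: w = 0 -> s = 0 /\ t = 0) ->
  forall z, pinned_flex z -> exists s t, z = s *: u + t *: w.
Proof.
have [[i [j [eq_e _ _]]] [p [q [eq_f _ _]]]] := (edges_inP eX, edges_inP fX).
move=> Su Sw indep z Sz.
pose le (y : config R V) := dot (y i - y j) (rho i - rho j).
pose lf (y : config R V) := dot (y p - y q) (rho p - rho q).
have leD s y t y' : le (s *: y + t *: y') = s * le y + t * le y'.
  by rewrite /le !ffunE opprD addrACA -!scalerBr dotDl !dotZl.
have lfD s y t y' : lf (s *: y + t *: y') = s * lf y + t * lf y'.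
  by rewrite /lf !ffunE opprD addrACA -!scalerBr dotDl !dotZl.
have S_comb s y t y' : pinned_flex y -> pinned_flex y' -> pinned_flex (s *: y + t *: y').
  move=> Sy Sy'; apply: (pinned_flex_lin _ Sy); rewrite -[t *: y']addr0.
  apply: (pinned_flex_lin _ Sy'); rewrite -(subrr y) addrC -scaleN1r.
  exact: pinned_flex_lin.
have eq0 y : pinned_flex y -> le y = 0 -> lf y = 0 -> y = 0.
  by move=> Sy /flex_eq_dot h1 /flex_eq_dot h2; exact: (pinned_flex_eq0 Sy eq_e eq_f).
pose D := le u * lf w - le w * lf u.
have D0 : D != 0.
  apply/eqP=> D0.
  (* If the determinant vanished, this combination and the next one would have both rates zero.
     Independence would then kill both rates of [u], so [u] itself. *)
  have [|lfw lfu] := indep (lf w) (- lf u).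
    apply: eq0; rewrite ?leD ?lfD; [exact: S_comb | | ring].
    by rewrite -[RHS]D0 /D; ring.
  have [|lew leu] := indep (le w) (- le u).
    apply: eq0; rewrite ?leD ?lfD; [exact: S_comb | ring |].
    by rewrite -[RHS]oppr0 -D0 /D; ring.
  have u0 : u = 0.
    apply: eq0 => //; apply/eqP; rewrite -oppr_eq0; exact/eqP.
  have [|/eqP] := indep 1 0; first by rewrite u0 scaler0 scale0r addr0.
  by rewrite oner_eq0.
(* Cramer's rule for the pair of rates of [z]. *)
exists ((le z * lf w - le w * lf z) / D), ((le u * lf z - le z * lf u) / D).
set s := _ / D; set t := _ / D.
apply/eqP; rewrite -subr_eq0 -scaleN1r addrC -[X in _ + X]scale1r; apply/eqP; apply: eq0.
- by do 2?apply: (S_comb).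
- by rewrite !leD /s /t; rewrite /D in D0 *; field.
- by rewrite !lfD /s /t; rewrite /D in D0 *; field.
Qed.

Lemma pinned_flex_hinge z : pinned_flex z -> dot (z d) (rho c - rho d) = 0.
Proof.
move=> [fz [_ _ zc]]; have /flex_eq_dot := imp_cd gen_rho fz.
by rewrite zc sub0r dotNl => /eqP; rewrite oppr_eq0 => /eqP.
Qed.

Definition extend (p : 'cV[R]_3) : config R (option V) :=
  [ffun o => if o is Some i then rho i else p].

Lemma inf_rigid_extend u1 u2 :
  pinned_flex u1 -> u1 d != 0 -> pinned_flex u2 -> u2 x != 0 ->
  exists p, inf_rigid (add_vertex H X) (extend p).
Proof.
move=> Su1 u1d Su2 u2x; have abc := abc_noncollinear.
(* Zero exactly on the plane through [rho a], [rho b] and [rho c]. *)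
pose T p := dot (cross (rho b - rho a) (rho c - rho a)) (p - rho a).
have cdx : cross (rho c - rho d) (rho x - rho d) != 0.
  apply: generic_noncollinear => //.
  rewrite (uniq_catCA [:: d] [:: c] [:: x]).
  by move: uniq_X; rewrite (cat_uniq [:: a; b] [:: c; d; x]) => /and3P[].
have [p [Tp good_p]] := good_position pinned_flex_lin pinned_flex_span pinned_flex_inj
  pinned_flex_hinge cdx (line_poly_dot _ _) (dot_witness (rho a) abc) Su1 u1d Su2 u2x.
exists p => u fu.
have rhoE i : extend p (Some i) = rho i by rewrite ffunE.
have abc' : cross (extend p (Some b) - extend p (Some a))
                  (extend p (Some c) - extend p (Some a)) != 0 by rewrite !rhoE.
pose res (y : config R (option V)) : config R V := [ffun i => y (Some i)].
have res_flex y i j : flex_eq (extend p) y (Some i) (Some j) <-> flex_eq rho (res y) i j.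
  by rewrite !flex_eq_dot !rhoE !ffunE.
have fres y : inf_flex (add_vertex H X) (extend p) y -> inf_flex H rho (res y).
  by move=> fy i j Hij; apply/res_flex; apply: fy.
have [||| w [tw wa wb wc]] := pin_triangle (u := u) abc'.
- by apply/res_flex/imp_ab => //; exact: fres.
- by apply/res_flex/imp_bc => //; exact: fres.
- by apply/res_flex/imp_ca => //; exact: fres.
pose y := u - w.
have fy : inf_flex (add_vertex H X) (extend p) y.
  by move=> i j ij; apply: flex_eq_sub; [exact: fu | exact: trivial_flex_eq].
have [ya yb yc] : [/\ y (Some a) = 0, y (Some b) = 0 & y (Some c) = 0].
  by rewrite !ffunE wa wb wc !subrr.
have new i : i \in X -> dot (y None - y (Some i)) (p - rho i) = 0.
  by move=> iX; have /flex_eq_dot := fy None (Some i) iX; rewrite rhoE [extend p None]ffunE.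
have [aX bX cX dX xX] : [/\ a \in X, b \in X, c \in X, d \in X & x \in X].
  by rewrite !mem_X !inE !eqxx !orbT.
have := new a aX; have := new b bX; have := new c cX.
rewrite ya yb yc !subr0 => nc nb na.
(* The velocity is orthogonal to [p - rho a] and, by taking differences, to the two edge vectors at
   [a]; these three are independent since [T p] is nonzero. *)
have y_new : y None = 0.
  apply: (frame_orthogonal_eq0 (p := p - rho a) (v := rho b - rho a) (w := rho c - rho a)) => //.
  - by rewrite dotC.
  - have -> : rho b - rho a = (p - rho a) - (p - rho b) by rewrite opprB [RHS]addrC addrA subrK.
    by rewrite dotBr na nb subrr.
  - have -> : rho c - rho a = (p - rho a) - (p - rho c) by rewrite opprB [RHS]addrC addrA subrK.
    by rewrite dotBr na nc subrr.
have resE i : res y i = y (Some i) by rewrite ffunE.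
(* With the new vertex at rest, its edges to [d] and [x] are the two conditions that [good_p]
   requires. *)
have res0 : res y = 0.
  apply: good_p.
  - by split; [exact: fres | rewrite !resE; split].
  - by have := new d dX; rewrite y_new sub0r dotNl -resE => /eqP; rewrite oppr_eq0 => /eqP.
  - by have := new x xX; rewrite y_new sub0r dotNl -resE => /eqP; rewrite oppr_eq0 => /eqP.
suff -> : u = w by [].
apply/eqP; rewrite -subr_eq0; apply/eqP/ffunP=> -[i|]; rewrite [RHS]ffunE //.
by have := congr1 (fun g : config R V => g i) res0; rewrite !ffunE.
Qed.

End Extension.

(* Assembling the dichotomy *)
Local Close Scope ring_scope.

Theorem corollary18 (R : realType) (V : finType) (G : sgraph V) (X : {set V})
    (e f : {set V}) :
  generically_3isostatic R G ->
  #|X| = 5 ->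
  e \in edges_in G X ->
  f \in edges_in G X ->
  e <> f ->
  (exists a b c d : V,
     uniq [:: a; b; c; d] /\
     [/\ a \in X, b \in X, c \in X & d \in X] /\
     [/\ implied_edge R (del_edges G [set e; f]) a b,
         implied_edge R (del_edges G [set e; f]) b c,
         implied_edge R (del_edges G [set e; f]) c a
       & implied_edge R (del_edges G [set e; f]) c d]) ->
  (exists S : {set V}, S \subset X /\ implied_K4 R (del_edges G [set e; f]) S) \/
  generically_3rigid R (add_vertex (del_edges G [set e; f]) X).
Proof.
move=> isoG cardX eX fX _ [a [b [c [d [uniq4 [[aX bX cX dX] [ab bc ca cd]]]]]]].
set H := del_edges G [set e; f] in ab bc ca cd *.
have [K4|nK4] := pselect (exists S : {set V}, S \subset X /\ implied_K4 R H S).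
  by left.
right; pose S4 := [set i in [:: a; b; c; d]].
have subX (y : V) : y \in X -> [set i in [:: a; b; c; y]] \subset X.
  by move=> yX; apply/subsetP=> i; rewrite !inE => /or4P[] /eqP ->.
have [x eq_x] : exists x, X :\: S4 = [set x].
  apply/cards1P; rewrite cardsDS ?subX // cardX cardsE (card_uniqP uniq4) //.
have : x \in X :\: S4 by rewrite eq_x set11.
rewrite in_setD inE => /andP[x4 xX].
have uniq5 : uniq [:: a; b; c; d; x].
  by rewrite -[[:: a; b; c; d; x]]/(rcons [:: a; b; c; d] x) rcons_uniq x4.
have mem_X : X =i [:: a; b; c; d; x].
  move=> i; rewrite -[[:: a; b; c; d; x]]/(rcons [:: a; b; c; d] x) mem_rcons in_cons.
  rewrite -(setID X S4) eq_x in_setU in_setI in_set1 inE orbC; congr (_ || _).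
  apply/andb_idl; rewrite !inE => /or4P[] /eqP -> //.
have uniq_abcx : uniq [:: a; b; c; x].
  apply: subseq_uniq uniq5.
  by rewrite (cat_subseq (subseq_refl [:: a; b; c]) (suffix_subseq [:: d] [:: x])).
have bad_pair y : y \in X -> uniq [:: a; b; c; y] ->
    exists i j, [/\ i \in [:: a; b; c; y], j \in [:: a; b; c; y] & ~ implied_edge R H i j].
  move=> yX uy; apply: contrapT => none; apply: nK4.
  exists [set i in [:: a; b; c; y]]; split; first exact: subX.
  split; first by rewrite cardsE (card_uniqP uy).
  move=> i j; rewrite !in_set => iS jS _; apply: contrapT => nij.
  by apply: none; exists i, j.
have [i1 [j1 [i1d j1d n1]]] := bad_pair d dX uniq4.
have [i2 [j2 [i2x j2x n2]]] := bad_pair x xX uniq_abcx.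
(* Without generic configurations every pair would be implied vacuously, contradicting [n1]. *)
have [rho gen_rho] : exists rho : config R V, generic rho.
  by apply: contrapT => none; apply: n1 => rho gen_rho; case: none; exists rho.
have rig_rho := (isoG rho gen_rho).1.
(* [implied_edge_generic] makes the failure visible at this very [rho]. If the pinned flex vanished
   at [y], it would vanish at [i] and [j] and satisfy their equation. *)
have pinned y i j : i \in [:: a; b; c; y] -> j \in [:: a; b; c; y] ->
    ~ implied_edge R H i j -> exists z, pinned_flex G e f rho a b c z /\ z y != 0%R.
  move=> iy jy nij.
  have [u [fu nu]] : exists u, inf_flex H rho u /\ ~ flex_eq rho u i j.
    apply: contrapT => none; apply: nij; apply: (implied_edge_generic gen_rho) => u fu.
    by apply: contrapT => nu; apply: none; exists u.
  have [z [Sz hz]] := exists_pinned_flex gen_rho uniq5 ab bc ca fu.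
  exists z; split=> //; apply/eqP=> zy; apply/nu/hz; have [_ [za zb zc]] := Sz.
  by apply: flex_eq_zero; [move: iy | move: jy]; rewrite !inE => /or4P[] /eqP ->.
have [u1 [Su1 u1d]] := pinned d _ _ i1d j1d n1.
have [u2 [Su2 u2x]] := pinned x _ _ i2x j2x n2.
have [p rig_p] := inf_rigid_extend gen_rho rig_rho eX fX uniq5 mem_X ab bc ca cd
  Su1 u1d Su2 u2x.
exact: inf_rigid_generic rig_p.
Qed.
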